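(* There is a one-to-one correspondence between skeletal 2-term sh Leibniz algebras with homotopy derivations and triples $((\mathfrak{g},\phi_\mathfrak{g}),(M,\phi_M),(\theta,\overline\theta))$, where $(\mathfrak{g},\phi_\mathfrak{g})$ is a LeibDer pair, $(M,\phi_M)$ is a representation of it, and $(\theta,\overline\theta)\in C^3_{\mathrm{LeibDer}}(\mathfrak{g},M)$ is a 3-cocycle in the cohomology of the LeibDer pair $(\mathfrak{g},\phi_\mathfrak{g})$ with coefficients in $(M,\phi_M)$.
   Context: All vector spaces and linear maps are over a field $\mathbb{K}$ of characteristic zero. A (right) Leibniz algebra is a vector space $\mathfrak{g}$ with a bilinear bracket satisfying $[[x,y],z]=[[x,z],y]+[x,[y,z]]$. A LeibDer pair $(\mathfrak{g},\phi_\mathfrak{g})$ is a Leibniz algebra with a derivation $\phi_\mathfrak{g}$ ($\phi_\mathfrak{g}[x,y]=[\phi_\mathfrak{g}(x),y]+[x,\phi_\mathfrak{g}(y)]$). A representation of $\mathfrak{g}$ is a vector space $M$ with bilinear maps $[\,,]:\mathfrak{g}\times M\to M$, $[\,,]:M\times\mathfrak{g}\to M$ such that $[[m,x],y]=[[m,y],x]+[m,[x,y]]$, $[[x,m],y]=[[x,y],m]+[x,[m,y]]$, $[[x,y],m]=[[x,m],y]+[x,[y,m]]$. A representation $(M,\phi_M)$ of $(\mathfrak{g},\phi_\mathfrak{g})$ is such an $M$ with a linear $\phi_M:M\to M$ satisfying $\phi_M[x,m]=[\phi_\mathfrak{g}(x),m]+[x,\phi_M(m)]$, $\phi_M[m,x]=[\phi_M(m),x]+[m,\phi_\mathfrak{g}(x)]$.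 For $f\in\mathrm{Hom}(\mathfrak{g}^{\otimes n},M)$ let $$(\delta_Lf)(x_1,\ldots,x_{n+1})=[x_1,f(x_2,\ldots,x_{n+1})]+\sum_{i=2}^{n+1}(-1)^i[f(x_1,\ldots,\widehat{x_i},\ldots,x_{n+1}),x_i]+\sum_{i<j}(-1)^{j+1}f(x_1,\ldots,x_{i-1},[x_i,x_j],x_{i+1},\ldots,\widehat{x_j},\ldots,x_{n+1}),$$ $$\delta f=\sum_{i=1}^nf\circ(\mathrm{id}\otimes\cdots\otimes\phi_\mathfrak{g}\otimes\cdots\otimes\mathrm{id})-\phi_M\circ f.$$ $C^n_{\mathrm{LeibDer}}(\mathfrak{g},M)=\mathrm{Hom}(\mathfrak{g}^{\otimes n},M)\times\mathrm{Hom}(\mathfrak{g}^{\otimes n-1},M)$ for $n\ge2$, with $\partial(f_n,\overline f_n)=(\delta_Lf_n,\delta_L\overline f_n+(-1)^n\delta f_n)$; a 3-cocycle is an element of $C^3_{\mathrm{LeibDer}}(\mathfrak{g},M)$ killed by $\partial$. A 2-term sh Leibniz algebra $(A_1\xrightarrow{d}A_0,l_2,l_3)$ is a chain complex $A_1\xrightarrow{d}A_0$ with bilinear maps $l_2:A_i\times A_j\to A_{i+j}$ ($0\le i,j,i+j\le1$) and a trilinear map $l_3:A_0\times A_0\times A_0\to A_1$ such that for $x,y,z,w\in A_0$, $m,n\in A_1$: - $dl_2(x,m)=l_2(x,dm)$, $dl_2(m,x)=l_2(dm,x)$, $l_2(dm,n)=l_2(m,dn)$; - $dl_3(x,y,z)=l_2(l_2(x,y),z)-l_2(l_2(x,z),y)-l_2(x,l_2(y,z))$;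 - $l_3(x,y,dm)=l_2(l_2(x,y),m)-l_2(l_2(x,m),y)-l_2(x,l_2(y,m))$; - $l_3(x,dm,y)=l_2(l_2(x,m),y)-l_2(l_2(x,y),m)-l_2(x,l_2(m,y))$; - $l_3(dm,x,y)=l_2(l_2(m,x),y)-l_2(l_2(m,y),x)-l_2(m,l_2(x,y))$; - $l_2(x,l_3(y,z,w))+l_2(l_3(x,z,w),y)-l_2(l_3(x,y,w),z)+l_2(l_3(x,y,z),w)=l_3(l_2(x,y),z,w)-l_3(l_2(x,z),y,w)+l_3(l_2(x,w),y,z)-l_3(x,l_2(y,z),w)+l_3(x,l_2(y,w),z)+l_3(x,y,l_2(z,w))$. It is skeletal if $d=0$. (Skeletal algebras are known to correspond bijectively to tuples $(\mathfrak{g},M,\theta)$ with $\mathfrak{g}=(A_0,l_2)$ a Leibniz algebra, $M=A_1$ a representation via $[x,m]=l_2(x,m)$, $[m,x]=l_2(m,x)$, and $\theta=l_3$ a Leibniz 3-cocycle.) A homotopy derivation on it is a triple $(\theta_0,\theta_1,\theta_2)$ with $\theta_0:A_0\to A_0$, $\theta_1:A_1\to A_1$ linear, $d\circ\theta_1=\theta_0\circ d$, and $\theta_2:A_0\times A_0\to A_1$ bilinear such that for $x,y,z\in A_0$, $m\in A_1$: (a) $d\theta_2(x,y)=\theta_0(l_2(x,y))-l_2(\theta_0(x),y)-l_2(x,\theta_0(y))$; (b) $\theta_2(x,dm)=\theta_1(l_2(x,m))-l_2(\theta_0(x),m)-l_2(x,\theta_1(m))$; (c) $\theta_2(dm,x)=\theta_1(l_2(m,x))-l_2(\theta_1(m),x)-l_2(m,\theta_0(x))$;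 (d) $l_3(\theta_0(x),y,z)+l_3(x,\theta_0(y),z)+l_3(x,y,\theta_0(z))-\theta_1l_3(x,y,z)=l_2(\theta_2(x,y),z)-l_2(\theta_2(x,z),y)-l_2(x,\theta_2(y,z))+\theta_2(l_2(x,y),z)-\theta_2(l_2(x,z),y)-\theta_2(x,l_2(y,z))$. *)

(* Defs.v *)
From HB Require Import structures.
From mathcomp Require Import all_boot all_order all_algebra.
From mathcomp Require Import sesquilinear.

Set Implicit Arguments.
Unset Strict Implicit.
Unset Printing Implicit Defensive.

Import GRing.Theory.
Local Open Scope ring_scope.

Record leibniz_algebra (K : fieldType) (g : lmodType K) := LeibnizAlgebra {
  bracket : {bilinear g -> g -> g};
  leibniz_identity : forall x y z,
    bracket (bracket x y) z = bracket (bracket x z) y + bracket x (bracket y z)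
}.

Record leibder_pair (K : fieldType) (g : lmodType K) := LeibDerPair {
  leibder_alg :> leibniz_algebra g;
  derivation : {linear g -> g};
  derivationP : forall x y,
    derivation (bracket leibder_alg x y) =
      bracket leibder_alg (derivation x) y + bracket leibder_alg x (derivation y)
}.

Record leibniz_rep (K : fieldType) (g M : lmodType K) (L : leibniz_algebra g) :=
  LeibnizRep {
  lact : {bilinear g -> M -> M};
  ract : {bilinear M -> g -> M};
  rep_mll : forall m x y,
    ract (ract m x) y = ract (ract m y) x + ract m (bracket L x y);
  rep_lml : forall x m y,
    ract (lact x m) y = lact (bracket L x y) m + lact x (ract m y);
  rep_llm : forall x y m,
    lact (bracket L x y) m = ract (lact x m) y + lact x (lact y m)
}.

Record leibder_rep (K : fieldType) (g M : lmodType K) (P : leibder_pair g) :=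
  LeibDerRep {
  leibder_rep_rep :> leibniz_rep M P;
  rep_map : {linear M -> M};
  rep_map_lact : forall x m,
    rep_map (lact leibder_rep_rep x m) =
      lact leibder_rep_rep (derivation P x) m
      + lact leibder_rep_rep x (rep_map m);
  rep_map_ract : forall m x,
    rep_map (ract leibder_rep_rep m x) =
      ract leibder_rep_rep (rep_map m) x
      + ract leibder_rep_rep m (derivation P x)
}.

(* Hom(g^{\otimes n}, M), as the n-linear maps g^n -> M. The arguments
   x_1, ..., x_n are indexed from 0, as x : 'I_n -> g.  *)
Record cochain (K : fieldType) (g M : lmodType K) (n : nat) := Cochain {
  cochain_fun :> ('I_n -> g) -> M;
  cochain_multilinear : forall (x : 'I_n -> g) (i : 'I_n),
    linear (fun v => cochain_fun [eta x with i |-> v])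
}.

(* With indices shifted to start from 0, the sign (-1)^i of the second term
   becomes (-1)^(i+1) and the sign (-1)^(j+1) of the third one becomes
   (-1)^(j+2) = (-1)^j. Precomposing with lift j omits the j-th argument.  *)
Definition leibniz_cobound (K : fieldType) (g M : lmodType K)
    (L : leibniz_algebra g) (R : leibniz_rep M L) (n : nat)
    (f : ('I_n -> g) -> M) (x : 'I_n.+1 -> g) : M :=
  lact R (x ord0) (f (x \o lift ord0))
  + \sum_(i < n.+1 | (0 < i)%N) (-1) ^+ i.+1 *: ract R (f (x \o lift i)) (x i)
  + \sum_(i < n.+1) \sum_(j < n.+1 | (i < j)%N)
      (-1) ^+ j *: f ([eta x with i |-> bracket L (x i) (x j)] \o lift j).

Definition der_cobound (K : fieldType) (g M : lmodType K)
    (P : leibder_pair g) (R : leibder_rep M P) (n : nat)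
    (f : ('I_n -> g) -> M) (x : 'I_n -> g) : M :=
  \sum_(i < n) f [eta x with i |-> derivation P (x i)] - rep_map R (f x).

(* C^n_LeibDer is only given by this formula for n >= 2, hence the index
   shift: leibder_cochain g M k is C^{k+2}_LeibDer(g, M), and 3-cocycles are
   obtained for k = 1.  *)
Definition leibder_cochain (K : fieldType) (g M : lmodType K) (k : nat) : Type :=
  (cochain g M k.+2 * cochain g M k.+1)%type.

Definition leibder_cobound (K : fieldType) (g M : lmodType K)
    (P : leibder_pair g) (R : leibder_rep M P) (k : nat)
    (c : leibder_cochain g M k) :
    (('I_k.+3 -> g) -> M) * (('I_k.+2 -> g) -> M) :=
  (leibniz_cobound R c.1,
   fun x => leibniz_cobound R c.2 x + (-1) ^+ k.+2 *: der_cobound R c.1 x).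

Record leibder_cocycle (K : fieldType) (g M : lmodType K)
    (P : leibder_pair g) (R : leibder_rep M P) (k : nat) := LeibDerCocycle {
  cocycle_cochain :> leibder_cochain g M k;
  cocycle_cobound1 : forall x, (leibder_cobound R cocycle_cochain).1 x = 0;
  cocycle_cobound2 : forall x, (leibder_cobound R cocycle_cochain).2 x = 0
}.

(* l_00, l_01 and l_10 are the components A_i x A_j -> A_(i+j) of l_2.  *)
Record sh_leibniz2 (K : fieldType) (A0 A1 : lmodType K) := ShLeibniz2 {
  sh_d : {linear A1 -> A0};
  l_00 : {bilinear A0 -> A0 -> A0};
  l_01 : {bilinear A0 -> A1 -> A1};
  l_10 : {bilinear A1 -> A0 -> A1};
  l_3 : A0 -> A0 -> A0 -> A1;
  l_3_linear1 : forall y z, linear (fun x => l_3 x y z);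
  l_3_linear2 : forall x z, linear (fun y => l_3 x y z);
  l_3_linear3 : forall x y, linear (fun z => l_3 x y z);
  sh_d_l01 : forall x m, sh_d (l_01 x m) = l_00 x (sh_d m);
  sh_d_l10 : forall m x, sh_d (l_10 m x) = l_00 (sh_d m) x;
  sh_d_l11 : forall m n, l_01 (sh_d m) n = l_10 m (sh_d n);
  sh_d_l3 : forall x y z,
    sh_d (l_3 x y z) =
      l_00 (l_00 x y) z - l_00 (l_00 x z) y - l_00 x (l_00 y z);
  sh_l3_xyd : forall x y m,
    l_3 x y (sh_d m) =
      l_01 (l_00 x y) m - l_10 (l_01 x m) y - l_01 x (l_01 y m);
  sh_l3_xdy : forall x m y,
    l_3 x (sh_d m) y =
      l_10 (l_01 x m) y - l_01 (l_00 x y) m - l_01 x (l_10 m y);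
  sh_l3_dxy : forall m x y,
    l_3 (sh_d m) x y =
      l_10 (l_10 m x) y - l_10 (l_10 m y) x - l_10 m (l_00 x y);
  sh_l3_coherence : forall x y z w,
    l_01 x (l_3 y z w) + l_10 (l_3 x z w) y
    - l_10 (l_3 x y w) z + l_10 (l_3 x y z) w =
      l_3 (l_00 x y) z w - l_3 (l_00 x z) y w + l_3 (l_00 x w) y z
      - l_3 x (l_00 y z) w + l_3 x (l_00 y w) z + l_3 x y (l_00 z w)
}.

Definition skeletal (K : fieldType) (A0 A1 : lmodType K)
    (A : sh_leibniz2 A0 A1) : Prop := forall m, sh_d A m = 0.

Record homotopy_derivation (K : fieldType) (A0 A1 : lmodType K)
    (A : sh_leibniz2 A0 A1) := HomotopyDerivation {
  theta0 : {linear A0 -> A0};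
  theta1 : {linear A1 -> A1};
  theta2 : {bilinear A0 -> A0 -> A1};
  theta_d : forall m, sh_d A (theta1 m) = theta0 (sh_d A m);
  theta2_a : forall x y,
    sh_d A (theta2 x y) =
      theta0 (l_00 A x y) - l_00 A (theta0 x) y - l_00 A x (theta0 y);
  theta2_b : forall x m,
    theta2 x (sh_d A m) =
      theta1 (l_01 A x m) - l_01 A (theta0 x) m - l_01 A x (theta1 m);
  theta2_c : forall m x,
    theta2 (sh_d A m) x =
      theta1 (l_10 A m x) - l_10 A (theta1 m) x - l_10 A m (theta0 x);
  theta2_d : forall x y z,
    l_3 A (theta0 x) y z + l_3 A x (theta0 y) z + l_3 A x y (theta0 z)
    - theta1 (l_3 A x y z) =
      l_10 A (theta2 x y) z - l_10 A (theta2 x z) y - l_01 A x (theta2 y z)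
      + theta2 (l_00 A x y) z - theta2 (l_00 A x z) y - theta2 x (l_00 A y z)
}.

Record skeletal_hder_on (K : fieldType) (A0 A1 : lmodType K) := SkeletalHDerOn {
  sk_sh :> sh_leibniz2 A0 A1;
  sk_skeletal : skeletal sk_sh;
  sk_hder : homotopy_derivation sk_sh
}.

Record leibder_triple_on (K : fieldType) (g M : lmodType K) := LeibDerTripleOn {
  tr_pair : leibder_pair g;
  tr_rep : leibder_rep M tr_pair;
  tr_cocycle : leibder_cocycle tr_rep 1
}.

Record skeletal_hder (K : fieldType) := SkeletalHDer {
  sk_A0 : lmodType K;
  sk_A1 : lmodType K;
  sk_str : skeletal_hder_on sk_A0 sk_A1
}.

Record leibder_triple (K : fieldType) := LeibDerTriple {
  tr_g : lmodType K;
  tr_M : lmodType K;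
  tr_str : leibder_triple_on tr_g tr_M
}.

(* The skeletal algebra ((A1 -0-> A0), l2, l3) corresponds to
   (g, M, theta) = (A0, A1, l3), and the homotopy derivation
   (theta0, theta1, theta2) to (phi_g, phi_M, thetabar) =
   (theta0, theta1, - theta2). The minus sign is forced by the conventions:
   theta2_d reads delta theta = - delta_L theta2, while the second component of
   a 3-cocycle satisfies delta_L thetabar - delta theta = 0.  *)
Definition corresponds (K : fieldType) (A0 A1 : lmodType K)
    (S : skeletal_hder_on A0 A1) (T : leibder_triple_on A0 A1) : Prop :=
  [/\ bracket (tr_pair T) =2 l_00 S,
      lact (tr_rep T) =2 l_01 S,
      ract (tr_rep T) =2 l_10 S &
      forall x : 'I_3 -> A0,
        (cocycle_cochain (tr_cocycle T)).1 x = l_3 S (x 0) (x 1) (x 2%:R)]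
  /\ [/\ derivation (tr_pair T) =1 theta0 (sk_hder S),
      rep_map (tr_rep T) =1 theta1 (sk_hder S) &
      forall x : 'I_2 -> A0,
        (cocycle_cochain (tr_cocycle T)).2 x = - theta2 (sk_hder S) (x 0) (x 1)].

(* Main.v *)
From HB Require Import structures.
Require Import Defs.
From mathcomp Require Import all_boot all_order all_algebra.
From mathcomp Require Import sesquilinear.
From Stdlib Require Import FunctionalExtensionality ProofIrrelevance.

Set Implicit Arguments.
Unset Strict Implicit.
Unset Printing Implicit Defensive.

Import GRing.Theory.
Local Open Scope ring_scope.

(** The data on the two sides are the same multilinear maps, and the axioms are
    the same equations; only their packaging differs.

    If d = 0, the axioms of a 2-term sh Leibniz algebra and of a homotopy
    derivation that involve d are of two kinds.  Those that compare d with l_2,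
    or with theta_0 and theta_1, read 0 = 0.  In the others one side vanishes:
    d l_3 = 0 is the Leibniz identity, the three values of l_3 on d m give the
    three axioms of a representation, and (a), (b), (c) say that theta_0 is a
    derivation and that theta_1 is compatible with it.  Each of these reads
    a - b - c = 0 for one structure and a = b + c for the other ([subr2_eq0]).

    The two axioms without d are the cocycle conditions.  On four arguments,
    delta_L l_3 is the difference of the two sides of the coherence of l_3
    ([leibniz_cobound3]).  With thetabar = - theta_2, the second component of the
    coboundary, delta_L thetabar - delta l_3, is the difference of the two sides
    of (d) ([leibder_cobound2]).

    This gives a map in each direction, and each of them produces an object in
    the relation [corresponds] with its argument ([leibder_of_skeletalP],
    [skeletal_of_leibderP]).  That relation compares all the maps except d,
    which is zero, so by extensionality and proof irrelevance it determines each
    side from the other ([corresponds_skeletal_uniq],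
    [corresponds_leibder_uniq]).  Hence the two maps are mutually inverse. *)

(** * Linear and bilinear maps *)

Lemma linear_ext (K : pzRingType) (U V : lmodType K) (f h : {linear U -> V}) :
  f =1 h -> f = h.
Proof.
case: f h => f [[cf1] [cf2]] [h [[ch1] [ch2]]] /= /functional_extensionality fh.
by subst h; rewrite (proof_irrelevance _ cf1 ch1) (proof_irrelevance _ cf2 ch2).
Qed.

Lemma bilinear_ext (K : nzRingType) (U V W : lmodType K)
    (f h : {bilinear U -> V -> W}) : f =2 h -> f = h.
Proof.
move=> fh; have {fh} : f = h :> (U -> V -> W).
  by apply: functional_extensionality => x; apply: functional_extensionality.
case: f h => f [[f1 f2 f3 f4]] [h [[h1 h2 h3 h4]]] /= fh; subst h.
rewrite (proof_irrelevance _ h1 f1) (proof_irrelevance _ h2 f2).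
by rewrite (proof_irrelevance _ h3 f3) (proof_irrelevance _ h4 f4).
Qed.

Lemma cochain_ext (K : fieldType) (g M : lmodType K) n (f h : cochain g M n) :
  f =1 h -> f = h.
Proof.
case: f h => f lin_f [h lin_h] /= /functional_extensionality fh; subst h.
by congr Cochain; exact: proof_irrelevance.
Qed.

Definition bilinear_of (K : nzRingType) (U V W : lmodType K) (f : U -> V -> W)
    (lin_l : forall v, linear (f ^~ v)) (lin_r : forall u, linear (f u)) :
  {bilinear U -> V -> W} :=
  HB.pack f (bilinear_isBilinear.Build K U V W *:%R *:%R f (lin_l, lin_r)).

(** The passage between an axiom of the homotopy structure, where d = 0 kills
    one side, and an axiom of a Leibniz algebra, derivation or representation. *)
Lemma subr2_eq0 (V : zmodType) (a b c : V) : a - b - c = 0 <-> a = b + c.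
Proof.
rewrite -addrA -opprD; split=> [/eqP | ->]; last exact: subrr.
by rewrite subr_eq0 => /eqP.
Qed.

Lemma linear_for0 (K : pzRingType) (U V : lmodType K) (f : U -> V) :
  linear f -> f 0 = 0.
Proof. by move=> lin_f; have := lin_f (-1) 0 0; rewrite !scaleN1r !addNr. Qed.

(** * Cochains of low degree on explicit arguments *)

(** Finite families given by lists: the operations on families in the
    coboundaries, replacing one argument and omitting one argument, then become
    list operations ([args_set_nth], [args_lift]) that compute. *)
Definition args (g : zmodType) n (s : seq g) : 'I_n -> g := fun i => s`_i.
Arguments args {g n} s i /.

Lemma args_set_nth (g : zmodType) n (s : seq g) (i : 'I_n) v :
  args (set_nth 0 s i v) = [eta args s with i |-> v].
Proof.
by apply: functional_extensionality => k; rewrite /args nth_set_nth /=.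
Qed.

Lemma args_onto (g : zmodType) n (x : 'I_n -> g) :
  exists t : n.-tuple g, x = args t.
Proof.
exists [tuple x i | i < n]; apply: functional_extensionality => i.
by rewrite /args -tnth_nth tnth_mktuple.
Qed.

Lemma args_lift (g : zmodType) n (s : seq g) (i : 'I_n.+1) :
  args s \o lift i = args (take i s ++ drop i.+1 s).
Proof.
apply: functional_extensionality => k; rewrite /args /= nth_cat size_take.
(* When i is beyond the end of s, both sides extend s by the default value 0. *)
rewrite /bump; case: (ltnP i (size s)) => [lt_is | le_si].
  case: (ltnP k i) => [lt_ki | le_ik]; first by rewrite nth_take.
  by rewrite nth_drop addSn subnKC.
rewrite take_oversize // drop_oversize ?nth_nil; last exact: leqW.
case: (ltnP k (size s)) => [lt_ks | le_sk].
  by rewrite leqNgt (leq_trans lt_ks).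
by rewrite nth_default // (leq_trans le_sk) // leq_addl.
Qed.

(** Grouped as minus the right-hand side of axiom (d) of a homotopy derivation
    with theta_2 = f, which is how the degree 2 coboundary is compared to it. *)
Lemma leibniz_cobound2 (K : fieldType) (g M : lmodType K)
    (L : leibniz_algebra g) (R : leibniz_rep M L) (f : ('I_2 -> g) -> M) x y z :
  leibniz_cobound R f (args [:: x; y; z]) =
    - (ract R (f (args [:: x; y])) z - ract R (f (args [:: x; z])) y
       - lact R x (f (args [:: y; z]))
       + f (args [:: bracket L x y; z]) - f (args [:: bracket L x z; y])
       - f (args [:: x; bracket L y z])).
Proof.
rewrite /leibniz_cobound.
do !rewrite big_mkcond !big_ord_recl big_ord0 /=.
rewrite !big_ord0 /=.
rewrite -!args_set_nth !args_lift /=.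
rewrite !(exprS, expr0, mulN1r, opprK, scale1r, scaleN1r).
rewrite !(add0r, addr0) !opprD !opprK !addrA; do 3!congr (_ + _).
by rewrite addrC [X in _ + X]addrC addrA.
Qed.

(** Grouped as the difference of the two sides of the coherence of l_3 = f. *)
Lemma leibniz_cobound3 (K : fieldType) (g M : lmodType K)
    (L : leibniz_algebra g) (R : leibniz_rep M L)
    (f : ('I_3 -> g) -> M) x y z w :
  leibniz_cobound R f (args [:: x; y; z; w]) =
    (lact R x (f (args [:: y; z; w])) + ract R (f (args [:: x; z; w])) y
     - ract R (f (args [:: x; y; w])) z + ract R (f (args [:: x; y; z])) w)
    - (f (args [:: bracket L x y; z; w]) - f (args [:: bracket L x z; y; w])
       + f (args [:: bracket L x w; y; z]) - f (args [:: x; bracket L y z; w])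
       + f (args [:: x; bracket L y w; z]) + f (args [:: x; y; bracket L z w])).
Proof.
rewrite /leibniz_cobound.
do !rewrite big_mkcond !big_ord_recl big_ord0 /=.
rewrite !big_ord0 /=.
rewrite -!args_set_nth !args_lift /=.
rewrite !(exprS, expr0, mulN1r, opprK, scale1r, scaleN1r).
by rewrite !(add0r, addr0) !opprD !opprK !addrA.
Qed.

Lemma der_cobound3 (K : fieldType) (g M : lmodType K)
    (P : leibder_pair g) (R : leibder_rep M P) (f : ('I_3 -> g) -> M) x y z :
  der_cobound R f (args [:: x; y; z]) =
    f (args [:: derivation P x; y; z]) + f (args [:: x; derivation P y; z])
    + f (args [:: x; y; derivation P z]) - rep_map R (f (args [:: x; y; z])).
Proof.
rewrite /der_cobound !big_ord_recl big_ord0 /= -!args_set_nth /=.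
by rewrite addr0 !addrA.
Qed.

(** For l_3 = c.1 and theta_2 = t, axiom (d) says that this vanishes.  The sign in
    the assumption on c.2 is the one in thetabar = - theta_2. *)
Lemma leibder_cobound2 (K : fieldType) (g M : lmodType K)
    (P : leibder_pair g) (R : leibder_rep M P) (c : leibder_cochain g M 1)
    (t : g -> g -> M) (ct : forall x y, c.2 (args [:: x; y]) = - t x y) x y z :
  (leibder_cobound R c).2 (args [:: x; y; z]) =
    (ract R (t x y) z - ract R (t x z) y - lact R x (t y z)
     + t (bracket P x y) z - t (bracket P x z) y - t x (bracket P y z))
    - (c.1 (args [:: derivation P x; y; z])
       + c.1 (args [:: x; derivation P y; z])
       + c.1 (args [:: x; y; derivation P z])
       - rep_map R (c.1 (args [:: x; y; z]))).
Proof.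
rewrite /= leibniz_cobound2 der_cobound3 !ct !(linearNl, linearNr).
by rewrite !(exprS, expr0, mulN1r, opprK, scaleN1r) !opprD !opprK.
Qed.

(** * From skeletal algebras to LeibDer pairs *)

Section FromSkeletal.

Variables (K : fieldType) (A0 A1 : lmodType K) (S : skeletal_hder_on A0 A1).

Fact sk_leibniz_identity x y z :
  l_00 S (l_00 S x y) z = l_00 S (l_00 S x z) y + l_00 S x (l_00 S y z).
Proof. by apply/subr2_eq0; rewrite -sh_d_l3 (sk_skeletal S). Qed.

Definition sk_leibniz := LeibnizAlgebra sk_leibniz_identity.

Fact sk_derivationP x y :
  theta0 (sk_hder S) (bracket sk_leibniz x y) =
    bracket sk_leibniz (theta0 (sk_hder S) x) y
    + bracket sk_leibniz x (theta0 (sk_hder S) y).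
Proof. by apply/subr2_eq0; rewrite -theta2_a (sk_skeletal S). Qed.

Definition sk_pair := LeibDerPair sk_derivationP.

Fact sk_rep_mll m x y :
  l_10 S (l_10 S m x) y =
    l_10 S (l_10 S m y) x + l_10 S m (bracket sk_pair x y).
Proof.
apply/subr2_eq0; rewrite -sh_l3_dxy (sk_skeletal S).
exact: (linear_for0 (l_3_linear1 S _ _)).
Qed.

Fact sk_rep_lml x m y :
  l_10 S (l_01 S x m) y =
    l_01 S (bracket sk_pair x y) m + l_01 S x (l_10 S m y).
Proof.
apply/subr2_eq0; rewrite -sh_l3_xdy (sk_skeletal S).
exact: (linear_for0 (l_3_linear2 S _ _)).
Qed.

Fact sk_rep_llm x y m :
  l_01 S (bracket sk_pair x y) m =
    l_10 S (l_01 S x m) y + l_01 S x (l_01 S y m).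
Proof.
apply/subr2_eq0; rewrite -sh_l3_xyd (sk_skeletal S).
exact: (linear_for0 (l_3_linear3 S _ _)).
Qed.

Definition sk_leibniz_rep := LeibnizRep sk_rep_mll sk_rep_lml sk_rep_llm.

Fact sk_rep_map_lact x m :
  theta1 (sk_hder S) (lact sk_leibniz_rep x m) =
    lact sk_leibniz_rep (derivation sk_pair x) m
    + lact sk_leibniz_rep x (theta1 (sk_hder S) m).
Proof. by apply/subr2_eq0; rewrite -theta2_b (sk_skeletal S) linear0r. Qed.

Fact sk_rep_map_ract m x :
  theta1 (sk_hder S) (ract sk_leibniz_rep m x) =
    ract sk_leibniz_rep (theta1 (sk_hder S) m) x
    + ract sk_leibniz_rep m (derivation sk_pair x).
Proof. by apply/subr2_eq0; rewrite -theta2_c (sk_skeletal S) linear0l. Qed.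

Definition sk_rep := LeibDerRep sk_rep_map_lact sk_rep_map_ract.

Definition sk_theta (x : 'I_3 -> A0) : A1 := l_3 S (x 0) (x 1) (x 2%:R).

Definition sk_theta_bar (x : 'I_2 -> A0) : A1 :=
  - theta2 (sk_hder S) (x 0) (x 1).

Fact sk_theta_multilinear (x : 'I_3 -> A0) (i : 'I_3) :
  linear (fun v => sk_theta [eta x with i |-> v]).
Proof.
case: i => -[|[|[|//]]] lt_i3.
- exact: l_3_linear1.
- exact: l_3_linear2.
- exact: l_3_linear3.
Qed.

Fact sk_theta_bar_multilinear (x : 'I_2 -> A0) (i : 'I_2) :
  linear (fun v => sk_theta_bar [eta x with i |-> v]).
Proof.
case: i => -[|[|//]] lt_i2 a u v.
  by rewrite /sk_theta_bar /= linearPl opprD scalerN.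
by rewrite /sk_theta_bar /= linearPr opprD scalerN.
Qed.

Definition sk_cochain : leibder_cochain A0 A1 1 :=
  (Cochain sk_theta_multilinear, Cochain sk_theta_bar_multilinear).

Fact sk_cobound1 x : (leibder_cobound sk_rep sk_cochain).1 x = 0.
Proof.
have [[[|a [|b [|c [|d []]]]] //= sz] ->] := args_onto x.
rewrite leibniz_cobound3; apply/eqP; rewrite subr_eq0.
exact/eqP/sh_l3_coherence.
Qed.

Fact sk_cobound2 x : (leibder_cobound sk_rep sk_cochain).2 x = 0.
Proof.
have [[[|a [|b [|c []]]] // sz] ->] := args_onto x.
rewrite (leibder_cobound2 _ (t := theta2 (sk_hder S))) //.
by apply/eqP; rewrite subr_eq0 eq_sym; apply/eqP/theta2_d.
Qed.

Definition leibder_of_skeletal : leibder_triple_on A0 A1 :=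
  LeibDerTripleOn (LeibDerCocycle sk_cobound1 sk_cobound2).

Lemma leibder_of_skeletalP : corresponds S leibder_of_skeletal.
Proof. by []. Qed.

End FromSkeletal.

(** * From LeibDer pairs to skeletal algebras *)

Section FromLeibDer.

Variables (K : fieldType) (A0 A1 : lmodType K) (T : leibder_triple_on A0 A1).

Local Notation "[ x , y ]" := (bracket (tr_pair T) x y).
Local Notation lact := (lact (tr_rep T)).
Local Notation ract := (ract (tr_rep T)).
Local Notation phi_g := (derivation (tr_pair T)).
Local Notation phi_M := (rep_map (tr_rep T)).
Local Notation cocycle := (cocycle_cochain (tr_cocycle T)).

Let theta x y z := cocycle.1 (args [:: x; y; z]).
Let theta_bar_opp x y := - cocycle.2 (args [:: x; y]).

Fact theta_linear1 y z : linear (fun x => theta x y z).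
Proof.
move=> a u v; rewrite /theta.
have := cochain_multilinear cocycle.1 (args [:: 0; y; z]) 0 a u v.
by rewrite -!args_set_nth.
Qed.

Fact theta_linear2 x z : linear (fun y => theta x y z).
Proof.
move=> a u v; rewrite /theta.
have := cochain_multilinear cocycle.1 (args [:: x; 0; z]) 1 a u v.
by rewrite -!args_set_nth.
Qed.

Fact theta_linear3 x y : linear (fun z => theta x y z).
Proof.
move=> a u v; rewrite /theta.
have := cochain_multilinear cocycle.1 (args [:: x; y; 0]) 2%:R a u v.
by rewrite -!args_set_nth.
Qed.

Fact theta_bar_opp_linear1 y : linear (theta_bar_opp ^~ y).
Proof.
move=> a u v; rewrite /theta_bar_opp scalerN -opprD; congr (- _).
have := cochain_multilinear cocycle.2 (args [:: 0; y]) 0 a u v.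
by rewrite -!args_set_nth.
Qed.

Fact theta_bar_opp_linear2 x : linear (theta_bar_opp x).
Proof.
move=> a u v; rewrite /theta_bar_opp scalerN -opprD; congr (- _).
have := cochain_multilinear cocycle.2 (args [:: x; 0]) 1 a u v.
by rewrite -!args_set_nth.
Qed.

Let d0 : {linear A1 -> A0} := \0.

Fact tr_d_l01 x m : d0 (lact x m) = [x, d0 m].
Proof. by rewrite linear0r. Qed.

Fact tr_d_l10 m x : d0 (ract m x) = [d0 m, x].
Proof. by rewrite linear0l. Qed.

Fact tr_d_l11 m n : lact (d0 m) n = ract m (d0 n).
Proof. by rewrite linear0l linear0r. Qed.

Fact tr_d_l3 x y z :
  d0 (theta x y z) =
    [[x, y], z] - [[x, z], y] - [x, [y, z]].
Proof. by apply/esym/subr2_eq0/leibniz_identity. Qed.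

Fact tr_l3_xyd x y m :
  theta x y (d0 m) =
    lact [x, y] m - ract (lact x m) y - lact x (lact y m).
Proof.
by rewrite (linear_for0 (theta_linear3 x y)); apply/esym/subr2_eq0/rep_llm.
Qed.

Fact tr_l3_xdy x m y :
  theta x (d0 m) y =
    ract (lact x m) y - lact [x, y] m - lact x (ract m y).
Proof.
by rewrite (linear_for0 (theta_linear2 x y)); apply/esym/subr2_eq0/rep_lml.
Qed.

Fact tr_l3_dxy m x y :
  theta (d0 m) x y =
    ract (ract m x) y - ract (ract m y) x - ract m [x, y].
Proof.
by rewrite (linear_for0 (theta_linear1 x y)); apply/esym/subr2_eq0/rep_mll.
Qed.

Fact tr_l3_coherence x y z w :
  lact x (theta y z w) + ract (theta x z w) y
  - ract (theta x y w) z + ract (theta x y z) w =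
    theta [x, y] z w - theta [x, z] y w
    + theta [x, w] y z - theta x [y, z] w
    + theta x [y, w] z + theta x y [z, w].
Proof.
have := cocycle_cobound1 (tr_cocycle T) (args [:: x; y; z; w]).
by rewrite /= leibniz_cobound3 => /eqP; rewrite subr_eq0 => /eqP.
Qed.

Definition tr_sh : sh_leibniz2 A0 A1 :=
  ShLeibniz2 theta_linear1 theta_linear2 theta_linear3 tr_d_l01 tr_d_l10
    tr_d_l11 tr_d_l3 tr_l3_xyd tr_l3_xdy tr_l3_dxy tr_l3_coherence.

Let tr_theta2 := bilinear_of theta_bar_opp_linear1 theta_bar_opp_linear2.

Fact tr_theta_d m :
  sh_d tr_sh (phi_M m) = phi_g (sh_d tr_sh m).
Proof. by rewrite /= linear0. Qed.

Fact tr_theta2_a x y :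
  sh_d tr_sh (tr_theta2 x y) =
    phi_g (l_00 tr_sh x y) - l_00 tr_sh (phi_g x) y - l_00 tr_sh x (phi_g y).
Proof. by apply/esym/subr2_eq0/derivationP. Qed.

Fact tr_theta2_b x m :
  tr_theta2 x (sh_d tr_sh m) =
    phi_M (l_01 tr_sh x m) - l_01 tr_sh (phi_g x) m - l_01 tr_sh x (phi_M m).
Proof. by rewrite linear0r; apply/esym/subr2_eq0/rep_map_lact. Qed.

Fact tr_theta2_c m x :
  tr_theta2 (sh_d tr_sh m) x =
    phi_M (l_10 tr_sh m x) - l_10 tr_sh (phi_M m) x - l_10 tr_sh m (phi_g x).
Proof. by rewrite linear0l; apply/esym/subr2_eq0/rep_map_ract. Qed.

Fact tr_theta2_d x y z :
  l_3 tr_sh (phi_g x) y z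
  + l_3 tr_sh x (phi_g y) z
  + l_3 tr_sh x y (phi_g z)
  - phi_M (l_3 tr_sh x y z) =
    l_10 tr_sh (tr_theta2 x y) z - l_10 tr_sh (tr_theta2 x z) y
    - l_01 tr_sh x (tr_theta2 y z)
    + tr_theta2 (l_00 tr_sh x y) z - tr_theta2 (l_00 tr_sh x z) y
    - tr_theta2 x (l_00 tr_sh y z).
Proof.
have := cocycle_cobound2 (tr_cocycle T) (args [:: x; y; z]).
rewrite (leibder_cobound2 _ (t := tr_theta2)) => [/eqP|u v].
  by rewrite subr_eq0 => /eqP ->.
by rewrite opprK.
Qed.

Definition tr_hder : homotopy_derivation tr_sh :=
  HomotopyDerivation tr_theta_d tr_theta2_a tr_theta2_b tr_theta2_c tr_theta2_d.

Definition skeletal_of_leibder : skeletal_hder_on A0 A1 :=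
  SkeletalHDerOn (sk_sh := tr_sh) (fun=> erefl) tr_hder.

Lemma skeletal_of_leibderP : corresponds skeletal_of_leibder T.
Proof.
split; split=> // x.
  by have [[[|a [|b [|c []]]] // sz] ->] := args_onto x.
by have [[[|a [|b []]] // sz] ->] := args_onto x; rewrite /= opprK.
Qed.

End FromLeibDer.

(** * The correspondence determines each side *)

Section Uniqueness.

Variables (K : fieldType) (A0 A1 : lmodType K).

Lemma sh_leibniz2_ext (A B : sh_leibniz2 A0 A1) :
    sh_d A =1 sh_d B -> l_00 A =2 l_00 B -> l_01 A =2 l_01 B ->
    l_10 A =2 l_10 B -> (forall x, l_3 A x =2 l_3 B x) ->
  A = B.
Proof.
move=> /linear_ext + /bilinear_ext + /bilinear_ext + /bilinear_ext + eq3.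
have {eq3} : l_3 A = l_3 B.
  by do 3![apply: functional_extensionality => ?]; apply: eq3.
case: A => d l00 l01 l10 l3 ? ? ? ? ? ? ? ? ? ? ?.
case: B => d' l00' l01' l10' l3' ? ? ? ? ? ? ? ? ? ? ? /=.
by do 5!move=> ?; subst; congr ShLeibniz2; exact: proof_irrelevance.
Qed.

(** Skeletality makes the two differentials equal, since both are zero. *)
Lemma skeletal_hder_on_ext (S S' : skeletal_hder_on A0 A1) :
    l_00 S =2 l_00 S' -> l_01 S =2 l_01 S' -> l_10 S =2 l_10 S' ->
    (forall x, l_3 S x =2 l_3 S' x) ->
    theta0 (sk_hder S) =1 theta0 (sk_hder S') ->
    theta1 (sk_hder S) =1 theta1 (sk_hder S') ->
    theta2 (sk_hder S) =2 theta2 (sk_hder S') ->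
  S = S'.
Proof.
case: S => A skA hA; case: S' => B skB hB /= e00 e01 e10 e3.
have eAB : A = B by apply: sh_leibniz2_ext => // m; rewrite skA skB.
subst B; rewrite (proof_irrelevance _ skB skA) {skB e00 e01 e10 e3}.
move=> /linear_ext + /linear_ext + /bilinear_ext.
case: hA => t0 t1 t2 ? ? ? ? ?; case: hB => t0' t1' t2' ? ? ? ? ? /= *; subst.
congr (SkeletalHDerOn _ (HomotopyDerivation _ _ _ _ _));
  exact: proof_irrelevance.
Qed.

Lemma leibder_triple_on_ext (T T' : leibder_triple_on A0 A1) :
    bracket (tr_pair T) =2 bracket (tr_pair T') ->
    derivation (tr_pair T) =1 derivation (tr_pair T') ->
    lact (tr_rep T) =2 lact (tr_rep T') ->
    ract (tr_rep T) =2 ract (tr_rep T') ->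
    rep_map (tr_rep T) =1 rep_map (tr_rep T') ->
    (cocycle_cochain (tr_cocycle T)).1 =1 (cocycle_cochain (tr_cocycle T')).1 ->
    (cocycle_cochain (tr_cocycle T)).2 =1 (cocycle_cochain (tr_cocycle T')).2 ->
  T = T'.
Proof.
case: T => -[[b hb] d hd] [[l r h1 h2 h3] p hl hr] [[c1 c2] z1 z2].
case: T' => -[[b' hb'] d' hd'] [[l' r' h1' h2' h3'] p' hl' hr'].
case=> [[c1' c2'] z1' z2'] /= /bilinear_ext eb /linear_ext ed; subst b' d'.
(* Each layer is identified, proofs included, before the next one, whose type
   depends on those proofs. *)
have ? := proof_irrelevance _ hb hb'; have ? := proof_irrelevance _ hd hd'.
subst hb' hd' => /bilinear_ext ? /bilinear_ext ? /linear_ext ?; subst l' r' p'.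
have ? := proof_irrelevance _ h1 h1'; have ? := proof_irrelevance _ h2 h2'.
have ? := proof_irrelevance _ h3 h3'; subst h1' h2' h3'.
have ? := proof_irrelevance _ hl hl'; have ? := proof_irrelevance _ hr hr'.
subst hl' hr' => /cochain_ext ? /cochain_ext ?; subst c1' c2'.
by congr (LeibDerTripleOn (LeibDerCocycle _ _)); exact: proof_irrelevance.
Qed.

Lemma corresponds_skeletal_uniq (S S' : skeletal_hder_on A0 A1)
    (T : leibder_triple_on A0 A1) :
  corresponds S T -> corresponds S' T -> S = S'.
Proof.
move=> [[b l r c1] [d p c2]] [[b' l' r' c1'] [d' p' c2']].
apply: skeletal_hder_on_ext => [x y|x m|m x|x y z|x|m|x y].
- by rewrite -b -b'.
- by rewrite -l -l'.
- by rewrite -r -r'.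
(* The values of l_3 and theta_2 are those of the cochains at explicit families,
   whose entries compute. *)
- by rewrite -[LHS](c1 (args [:: x; y; z])) -[RHS](c1' (args [:: x; y; z])).
- by rewrite -d -d'.
- by rewrite -p -p'.
- apply: oppr_inj.
  by rewrite -[LHS](c2 (args [:: x; y])) -[RHS](c2' (args [:: x; y])).
Qed.

Lemma corresponds_leibder_uniq (S : skeletal_hder_on A0 A1)
    (T T' : leibder_triple_on A0 A1) :
  corresponds S T -> corresponds S T' -> T = T'.
Proof.
move=> [[b l r c1] [d p c2]] [[b' l' r' c1'] [d' p' c2']].
apply: leibder_triple_on_ext => [x y|x|x m|m x|m|x|x].
- by rewrite b b'.
- by rewrite d d'.
- by rewrite l l'.
- by rewrite r r'.
- by rewrite p p'.
- by rewrite c1 c1'.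
- by rewrite c2 c2'.
Qed.

End Uniqueness.

Theorem proposition6p5 (K : fieldType) (charK0 : [pchar K] =i pred0) :
  exists F : forall A0 A1 : lmodType K,
      skeletal_hder_on A0 A1 -> leibder_triple_on A0 A1,
    bijective (fun S : skeletal_hder K =>
      LeibDerTriple (F (sk_A0 S) (sk_A1 S) (sk_str S)))
    /\ forall (A0 A1 : lmodType K) (S : skeletal_hder_on A0 A1),
         corresponds S (F A0 A1 S).
Proof.
exists (@leibder_of_skeletal K); split; last exact: leibder_of_skeletalP.
exists (fun T => SkeletalHDer (skeletal_of_leibder (tr_str T)));
  move=> [A0 A1 X] /=.
  congr SkeletalHDer.
  apply: corresponds_skeletal_uniq (skeletal_of_leibderP _) _.
  exact: leibder_of_skeletalP.
congr LeibDerTriple; apply: corresponds_leibder_uniq (leibder_of_skeletalP _) _.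
exact: skeletal_of_leibderP.
Qed.
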